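(* Let $p\ge 1$, $k\ge 1$ and $r\in\{0,\dots,p-1\}$ be integers, and let $q=p-r$. Suppose the model $(c,\{f_i\}_{i=0}^k)$ belongs to the class $\mathcal M_r$ (defined in the context), with associated $\alpha$, $\mu$, $\theta$, $\mathcal B$. Suppose that, given initial values $z_0,z_{-1},\dots,z_{-k+1}\in\mathbb R^p$ and a sequence $\{u_t\}_{t\ge1}$ in $\mathbb R^p$, the sequence $\{z_t\}$ satisfies $f_0(z_t)=c+\sum_{i=1}^k f_i(z_{t-i})+u_t$ for all $t\ge1$. Then the map $\chi:\mathbb R^p\to\mathbb R^p$ is a homeomorphism and, for all $t\ge1$, $$z_t=\chi^{-1}\left(\begin{bmatrix}\alpha_\perp^\top\bar h(\vec z_0)+\alpha_\perp^\top\sum_{s=1}^t u_s\\ -\mu\end{bmatrix}+S_\chi^\top\boldsymbol\xi_t\right),$$ where $\vec z_0=(z_0^\top,\dots,z_{-k+1}^\top)^\top$, $\bar h(\vec z_0)\defeq f_0(z_0)-\sum_{i=1}^{k-1}g_i(z_{-i})$, $$S_\chi^\top\defeq\begin{bmatrix}-\alpha_\perp^\top & 0\\ 0 & I_r\end{bmatrix}\begin{bmatrix}0_{p\times r} & I_p & \cdots & I_p\\ I_r & 0_{r\times p} & \cdots & 0_{r\times p}\end{bmatrix}\in\mathbb R^{p\times[p(k-1)+r]},$$ and $$\boldsymbol\xi_t\defeq\begin{bmatrix}\mu\\0_{p(k-1)}\end{bmatrix}+\boldsymbol\theta(z_t)+\mathbf D_0\mathbf z_t=\begin{bmatrix}\mu+\theta(z_t)\\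 \Delta\boldsymbol\zeta_t\end{bmatrix},$$ with $\mathbf z_t=(z_t^\top,\boldsymbol\zeta_{t-1}^\top)^\top$, $\boldsymbol\zeta_t=(\zeta_{1,t}^\top,\dots,\zeta_{k-1,t}^\top)^\top$, $\zeta_{j,t}=\sum_{i=j}^{k-1}g_i(z_{t-i+j})$. Moreover $\{\boldsymbol\xi_t\}$ follows the exponentially stable time-varying VAR $$\boldsymbol\xi_t=(I_{p(k-1)+r}+\boldsymbol\beta_t^\top\boldsymbol\alpha)\boldsymbol\xi_{t-1}+\boldsymbol\beta_t^\top\mathbf u_t,\qquad \mathbf u_t=(u_t^\top,0_{1\times p(k-1)})^\top,$$ with $\boldsymbol\beta_t\in\mathcal B$ for all $t$.
   Context: Model: for $c\in\mathbb R^p$ and maps $f_0,\dots,f_k:\mathbb R^p\to\mathbb R^p$ with $f_i(0)=0$, a sequence $\{z_t\}$ follows the nonlinear VAR($k$) with shocks $u_t$ if $f_0(z_t)=c+\sum_{i=1}^k f_i(z_{t-i})+u_t$. (When $k=1$, all blocks indexed by $1,\dots,k-1$ below are empty.) Define $g_j(z)=-\sum_{i=j+1}^k f_i(z)$ for $j=0,\dots,k-1$; $\pi(z)=-f_0(z)+\sum_{i=1}^k f_i(z)$; $\mathbf g(z)=(g_1(z)^\top,\dots,g_{k-1}(z)^\top)^\top\in\mathbb R^{p(k-1)}$. Let $D\in\mathbb R^{p(k-1)\times p(k-1)}$ be the block matrix with $-I_p$ in each diagonal block, $I_p$ in each block immediately above the diagonal, and zeros elsewhere; $E=(I_p,0_{p\times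 p(k-2)})^\top\in\mathbb R^{p(k-1)\times p}$. For $\alpha\in\mathbb R^{p\times r}$ of rank $r$, $\alpha_\perp$ is a $p\times(p-r)$ matrix of rank $p-r$ with $\alpha_\perp^\top\alpha=0$, and $\boldsymbol\alpha=\begin{bmatrix}\alpha & E^\top\\ 0 & I_{p(k-1)}\end{bmatrix}$. For $\theta:\mathbb R^p\to\mathbb R^r$, $\boldsymbol\theta(z)=(\theta(z)^\top,\mathbf g(z)^\top)^\top$ and $\mathbf D_0=\begin{bmatrix}0_{r\times p}&0\\0_{p(k-1)\times p}&D\end{bmatrix}$. For a bounded set $\mathcal A$ of square matrices, its joint spectral radius is $\rho_{JSR}(\mathcal A)=\limsup_{t\to\infty}\sup\{\rho(M_1\cdots M_t)^{1/t}:M_s\in\mathcal A\}$, $\rho$ the spectral radius. Class $\mathcal M_r(\alpha,\bar b,\bar\rho)$ (for $\alpha\in\mathbb R^{p\times r}$ of rank $r$, $\bar b\in\mathbb R$, $\bar\rho\in[0,1)$): the model $(c,\{f_i\}_{i=0}^k)$ belongs to it if (i) $f_0$ is a homeomorphism of $\mathbb R^p$; (ii) there exist $\mu\in\mathbb R^r$ and $\theta:\mathbb R^p\to\mathbb R^r$ with $c=\alpha\mu$ and $\pi(z)=\alpha\theta(z)$ for all $z$; (iii) there is a closed set $\mathcal B\subset\mathbb R^{kp\times[p(k-1)+r]}$ with $\max_{\boldsymbol\beta\in\mathcal B}\|\boldsymbol\beta\|\le\bar b$ and $\rho_{JSR}(\{I_{p(k-1)+r}+\boldsymbol\beta^\top\boldsymbol\alpha:\boldsymbol\beta\in\mathcal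 B\})\le\bar\rho$, such that for all $\mathbf z=(z^\top,\boldsymbol\zeta^\top)^\top,\mathbf z'=(z'^\top,\boldsymbol\zeta'^\top)^\top\in\mathbb R^p\times\mathbb R^{p(k-1)}$ there is $\boldsymbol\beta\in\mathcal B$ with $[\boldsymbol\theta(f_0^{-1}(z))+\mathbf D_0\mathbf z]-[\boldsymbol\theta(f_0^{-1}(z'))+\mathbf D_0\mathbf z']=\boldsymbol\beta^\top(\mathbf z-\mathbf z')$. $\mathcal M_r$ is the union of these classes over all $\alpha$ of rank $r$, $\bar b<\infty$, $\bar\rho<1$. Given such a model, define $h(z)=f_0(z)-\sum_{i=1}^{k-1}g_i(z)$, $\psi(z)=\alpha_\perp^\top h(z)$, and $\chi(z)=(\psi(z)^\top,\theta(z)^\top)^\top$. Exponential stability: a sequence $w_t=c_t+A_tw_{t-1}+B_tv_t$ ($t\in\mathbb N$) with $A_t\in\mathscr A$, $B_t\in\mathscr B$, $c_t\in\mathscr C$ is exponentially stable if $\mathscr B,\mathscr C$ are bounded and there exist $C<\infty$, $\rho\in[0,1)$ with $\|\prod_{s=1}^tA_s\|\le C\rho^t$ for all $t$. *)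

(* Defs.v *)
From HB Require Import structures.
From mathcomp Require Import all_boot all_order all_algebra.
From mathcomp Require Import all_classical all_reals all_analysis.
From mathcomp.real_closed Require Import complex.
Set Implicit Arguments.
Unset Strict Implicit.
Unset Printing Implicit Defensive.
Import Order.TTheory GRing.Theory Num.Theory numFieldNormedType.Exports.
Local Open Scope classical_set_scope.
Local Open Scope ring_scope.

Section Defs.
Variable R : realType.

Definition homeo (n : nat) (f finv : 'cV[R]_n -> 'cV[R]_n) : Prop :=
  [/\ cancel f finv, cancel finv f, continuous f & continuous finv].

(** Spectral radius: the largest modulus of a complex eigenvalue
    (0 for the empty matrix). *)
Definition spec_rad (n : nat) (M : 'M[R]_n) : R :=
  sup [set x : R | exists2 l : R[i],
         eigenvalue (map_mx (fun a : R => Complex a 0) M) l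
       & Complex x 0 = `|l|].

Definition mxprod (n : nat) (Ms : nat -> 'M[R]_n) (t : nat) : 'M[R]_n :=
  \big[mulmx/1%:M]_(1 <= s < t.+1) Ms s.

Definition jsr (n : nat) (A : set 'M[R]_n) : \bar R :=
  limn_esup (fun t : nat =>
    ereal_sup [set ((spec_rad (mxprod Ms t)) `^ (t%:R^-1))%:E
              | Ms in [set Ms : nat -> 'M[R]_n |
                        forall s, (1 <= s <= t)%N -> A (Ms s)]]).

Definition gj (p k : nat) (f : nat -> 'cV[R]_p -> 'cV[R]_p) (j : nat)
  (z : 'cV[R]_p) : 'cV[R]_p :=
  - \sum_(j.+1 <= i < k.+1) f i z.

Definition pimap (p k : nat) (f : nat -> 'cV[R]_p -> 'cV[R]_p)
  (z : 'cV[R]_p) : 'cV[R]_p :=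
  - f 0%N z + \sum_(1 <= i < k.+1) f i z.

(** stacking (v 0; v 1; ...; v (m-1)) into R^{m p}; block a occupies the
    indices a*p, ..., a*p + p - 1 (mxvec is row-major). *)
Definition bstack (m p : nat) (v : nat -> 'cV[R]_p) : 'cV[R]_(m * p) :=
  (mxvec (\matrix_(a < m, j < p) v a j 0))^T.

Definition boldg (p k : nat) (f : nat -> 'cV[R]_p -> 'cV[R]_p)
  (z : 'cV[R]_p) : 'cV[R]_(k.-1 * p) :=
  bstack k.-1 (fun a => gj k f a.+1 z).

(** D: -I_p on diagonal blocks, I_p on the blocks just above the diagonal. *)
Definition Dmat (m p : nat) : 'M[R]_(m * p) :=
  \matrix_(i, j) (if i == j then -1
                  else if (j : nat) == (i + p)%N then 1 else 0).

Definition Emat (m p : nat) : 'M[R]_(m * p, p) :=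
  \matrix_(i, j) ((i : nat) == (j : nat))%:R.

Definition bold_alpha (p r m : nat) (al : 'M[R]_(p, r)) :
  'M[R]_(p + m * p, r + m * p) :=
  block_mx al (Emat m p)^T 0 1%:M.

Definition bold_theta (p r k : nat) (f : nat -> 'cV[R]_p -> 'cV[R]_p)
  (th : 'cV[R]_p -> 'cV[R]_r) (z : 'cV[R]_p) : 'cV[R]_(r + k.-1 * p) :=
  col_mx (th z) (boldg k f z).

Definition D0mat (p r m : nat) : 'M[R]_(r + m * p, p + m * p) :=
  block_mx 0 0 0 (Dmat m p).

Definition hmap (p k : nat) (f : nat -> 'cV[R]_p -> 'cV[R]_p)
  (z : 'cV[R]_p) : 'cV[R]_p :=
  f 0%N z - \sum_(1 <= i < k) gj k f i z.

Definition chi (q r k : nat) (f : nat -> 'cV[R]_(q + r) -> 'cV[R]_(q + r))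
  (alperp : 'M[R]_(q + r, q)) (th : 'cV[R]_(q + r) -> 'cV[R]_r)
  (z : 'cV[R]_(q + r)) : 'cV[R]_(q + r) :=
  col_mx (alperp^T *m hmap k f z) (th z).

Definition hbar (p k : nat) (f : nat -> 'cV[R]_p -> 'cV[R]_p)
  (z : int -> 'cV[R]_p) : 'cV[R]_p :=
  f 0%N (z 0) - \sum_(1 <= i < k) gj k f i (z (- (i%:Z))).

Definition zeta (p k : nat) (f : nat -> 'cV[R]_p -> 'cV[R]_p)
  (z : int -> 'cV[R]_p) (j : nat) (t : int) : 'cV[R]_p :=
  \sum_(j <= i < k) gj k f i (z (t - i%:Z + j%:Z)).

Definition bzeta (p k : nat) (f : nat -> 'cV[R]_p -> 'cV[R]_p)
  (z : int -> 'cV[R]_p) (t : int) : 'cV[R]_(k.-1 * p) :=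
  bstack k.-1 (fun a => zeta k f z a.+1 t).

Definition bxi (p r k : nat) (f : nat -> 'cV[R]_p -> 'cV[R]_p)
  (mu : 'cV[R]_r) (th : 'cV[R]_p -> 'cV[R]_r) (z : int -> 'cV[R]_p)
  (t : int) : 'cV[R]_(r + k.-1 * p) :=
  col_mx mu 0 + bold_theta k f th (z t)
  + D0mat p r k.-1 *m col_mx (z t) (bzeta k f z (t - 1)).

(** the p x p(k-1) block row (I_p ... I_p) *)
Definition Irow (m p : nat) : 'M[R]_(p, m * p) :=
  \matrix_(i, j) (((j : nat) %% p)%N == (i : nat))%:R.

Definition S_chiT (q r m : nat) (alperp : 'M[R]_(q + r, q)) :
  'M[R]_(q + r, r + m * (q + r)) :=
  block_mx (- alperp^T) 0 0 1%:M *m block_mx 0 (Irow m (q + r)) 1%:M 0.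

Definition bu (p m : nat) (u : int -> 'cV[R]_p) (t : int) : 'cV[R]_(p + m * p) :=
  col_mx (u t) 0.

(** Exponential stability of w_t = c_t + A_t w_{t-1} + B_t v_t (t >= 1):
    the sets of the B_t and of the c_t are bounded, and
    || A_1 ... A_t || <= C rho^t for some C and rho in [0,1).
    Matrix norms are the (max-entry) norm of MathComp-Analysis. *)
Definition exp_stable (n m : nat) (c : nat -> 'cV[R]_n) (A : nat -> 'M[R]_n)
  (Bm : nat -> 'M[R]_(n, m)) (w : nat -> 'cV[R]_n) (v : nat -> 'cV[R]_m) : Prop :=
  [/\ (forall t, (1 <= t)%N -> w t = c t + A t *m w t.-1 + Bm t *m v t),
      (exists M : R, forall t, (1 <= t)%N -> `|Bm t| <= M),
      (exists M : R, forall t, (1 <= t)%N -> `|c t| <= M)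
    & (exists C rho : R, 0 <= rho < 1 /\ forall t, `|mxprod A t| <= C * rho ^+ t)].

End Defs.

Arguments Dmat {R} m p.
Arguments Emat {R} m p.
Arguments D0mat {R} p r m.
Arguments Irow {R} m p.

(* Main.v *)
Require Import Defs.
From HB Require Import structures.
From mathcomp Require Import all_boot all_order all_algebra.
From mathcomp Require Import all_classical all_reals all_analysis.
From mathcomp.real_closed Require Import complex.
From mathcomp Require Import perm ring lra zify.
Set Implicit Arguments.
Unset Strict Implicit.
Unset Printing Implicit Defensive.
Import Order.TTheory GRing.Theory Num.Theory numFieldNormedType.Exports.
Local Open Scope classical_set_scope.
Local Open Scope ring_scope.

(* The crux is a Berger-Wang theorem: if all products of large length t of a
   bounded family have spectral radius at most r^t for a fixed r < 1, then their
   norms decay exponentially.  A bounded monoid of n x n matrices is conjugate to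
   one with entries at most 2, which makes one step of a pigeonhole argument
   uniform over families; iterating it from a contractive multiple of the family
   gives the theorem without the usual reduction to irreducible families.

   For the model, put Z_t = (f_0(z_t), zeta_{t-1}): the identities
   xi_t - xi_{t-1} = beta_t^T (Z_t - Z_{t-1}) and
   Z_t - Z_{t-1} = bold_alpha xi_{t-1} + bold_u_t give the time-varying VAR.
   Inverting chi amounts to finding a fixed point of a map whose increments are
   of the form I + beta^T bold_alpha, hence some iterate of which is a
   contraction; this also gives Lipschitz bounds, so that no invariance of domain
   is needed. *)

(** * Norms, conjugation and pigeonhole for bounded sets of matrices *)

Lemma mx_norm_entry (R : realType) m n (X : 'M[R]_(m, n)) i j : `|X i j| <= `|X|.
Proof.
rewrite [leRHS]/Num.Def.normr /= mx_normrE.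
by apply/bigmax_geP; right; exists (i, j).
Qed.

Lemma mx_norm_le (R : realType) m n (X : 'M[R]_(m, n)) (a : R) :
  0 <= a -> (forall i j, `|X i j| <= a) -> `|X| <= a.
Proof.
move=> a0 Xa; rewrite [leLHS]/Num.Def.normr /= mx_normrE.
by apply/bigmax_leP; split => // -[i j] _ /=.
Qed.

Lemma mx_normM (R : realType) m n q (X : 'M[R]_(m, n)) (Y : 'M[R]_(n, q)) :
  `|X *m Y| <= n%:R * `|X| * `|Y|.
Proof.
apply: mx_norm_le => [|i j]; first by rewrite !mulr_ge0.
rewrite mxE (le_trans (ler_norm_sum _ _ _))//.
apply: (@le_trans _ _ (\sum_(k < n) `|X| * `|Y|)).
  by apply: ler_sum => k _; rewrite normrM ler_pM ?mx_norm_entry.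
by rewrite sumr_const card_ord -mulrA mulr_natl.
Qed.

Lemma mx_norm_tr (R : realType) m n (X : 'M[R]_(m, n)) : `|X^T| = `|X|.
Proof.
by apply/eqP; rewrite eq_le; apply/andP; split; apply: mx_norm_le => // i j;
  [rewrite mxE | have -> : X i j = X^T j i by rewrite mxE]; exact: mx_norm_entry.
Qed.

Lemma mx_norm1 (R : realType) n : `|1%:M : 'M[R]_n| <= 1.
Proof.
by apply: mx_norm_le => // i j; rewrite mxE; case: eqP; rewrite ?normr1 ?normr0.
Qed.

Lemma det_bound (R : realType) n (X : 'M[R]_n) (K : R) :
  (forall i j, `|X i j| <= K) -> `|\det X| <= (n`!)%:R * K ^+ n.
Proof.
move=> XK; rewrite /determinant (le_trans (ler_norm_sum _ _ _))//.
apply: (@le_trans _ _ (\sum_(s : {perm 'I_n}) K ^+ n)).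
  apply: ler_sum => s _; rewrite normrM normrX normrN1 expr1n mul1r normr_prod.
  rewrite -[leRHS](_ : \prod_(i < n) K = _); last by rewrite prodr_const card_ord.
  by apply: ler_prod => i _; rewrite normr_ge0 XK.
rewrite sumr_const mulr_natl. by rewrite card_Sn.
Qed.

Lemma adj_bound (R : realType) n (K : R) :
  exists2 C : R, 0 <= C & forall X : 'M[R]_n, `|X| <= K -> `|\adj X| <= C.
Proof.
exists (n.-1`!%:R * `|K| ^+ n.-1) => [|X XK]; first by rewrite mulr_ge0 ?exprn_ge0.
apply: mx_norm_le => [|i j]; first by rewrite mulr_ge0 ?exprn_ge0.
rewrite mxE /cofactor normrM normrX normrN1 expr1n mul1r.
apply: det_bound => a b; rewrite !mxE.
by rewrite (le_trans (mx_norm_entry _ _ _))// (le_trans XK)// ler_norm.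
Qed.

(** Cramer's rule, by expansion along column [i]: its cofactors do not see the replaced entries. *)
Lemma det_set_col (R : comNzRingType) n (V : 'M[R]_n) (x : 'cV[R]_n) (i : 'I_n) :
  \det (\matrix_(a, b) (if b == i then x a 0 else V a b)) = (\adj V *m x) i 0.
Proof.
rewrite (expand_det_col _ i) mxE; apply: eq_bigr => a _.
rewrite !mxE eqxx mulrC; congr (_ * _).
rewrite /cofactor; congr (_ * \det _).
by apply/matrixP => b d; rewrite !mxE eq_sym (negbTE (neq_lift _ _)).
Qed.

(* Choose [V] among the matrices whose columns are columns of elements of [S],
   with [`|\det V|] at least half the supremum: by Cramer's rule the columns
   of all elements of [S] then have coordinates at most [2] in the basis [V]. *)
Lemma bounded_monoid_conj (R : realType) n (S : set 'M[R]_n) (K : R) :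
  S 1%:M -> (forall X Y, S X -> S Y -> S (X *m Y)) ->
  (forall X, S X -> `|X| <= K) ->
  exists2 V : 'M[R]_n, V \in unitmx & forall X, S X -> `|invmx V *m X *m V| <= 2.
Proof.
move=> S1 SM SK.
pose cols := [set W : 'M[R]_n | forall i, exists X j, S X /\ col i W = col j X].
pose E := [set `|\det W| | W in cols].
have supE : has_sup E.
  split; first by exists `|\det (1%:M : 'M[R]_n)|; exists 1%:M => // i; exists 1%:M, i.
  exists (n`!%:R * K ^+ n) => _ [W Wc <-]; apply: det_bound => i j.
  have [X [l [SX WX]]] := Wc j.
  have -> : W i j = X i l by have := congr1 (fun c : 'cV_n => c i 0) WX; rewrite !mxE.
  by rewrite (le_trans (mx_norm_entry _ _ _))// SK.
have sup1 : 1 <= sup E.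
  apply: (sup_upper_bound supE); exists 1%:M; last by rewrite det1 normr1.
  by move=> i; exists 1%:M, i.
have e0 : 0 < sup E / 2 by lra.
have [_ [V Vc <-] Vsup] := sup_adherent e0 supE.
have detV : sup E / 2 < `|\det V| by lra.
have V0 : \det V != 0 by rewrite -normr_gt0; lra.
have Vu : V \in unitmx by rewrite unitmxE unitfE.
exists V => // X SX; apply: mx_norm_le => // i j.
pose x : 'cV_n := X *m col j V.
have -> : (invmx V *m X *m V) i j = (\det V)^-1 * (\adj V *m x) i 0.
  have -> : (invmx V *m X *m V) i j = col j (invmx V *m X *m V) i 0 by rewrite [RHS]mxE.
  by rewrite !colE -!mulmxA -colE -/x /invmx Vu -scalemxAl mxE.
rewrite -det_set_col normrM normfV mulrC ler_pdivrMr ?normr_gt0//.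
(* The modified matrix is again in [cols], as [X] times a column of [X'] is a column of [X *m X'];
   its determinant is thus at most [sup E], and [sup E / 2] is below that of [V]. *)
apply: (@le_trans _ _ (sup E)); last lra.
apply: (sup_upper_bound supE); eexists; last by [].
move=> b; have [X' [l [SX' VX']]] := Vc j; have [->|bi] := eqVneq b i.
  exists (X *m X'), l; split; first exact: SM.
  apply/colP => a; rewrite [LHS]mxE [LHS]mxE eqxx /x VX' !mxE.
  by apply: eq_bigr => d _; rewrite !mxE.
have [Y [l' [SY VY]]] := Vc b; exists Y, l'; split => //.
by rewrite -VY; apply/colP => a; rewrite !mxE (negbTE bi).
Qed.

Lemma bounded_mx_pigeonhole (R : realType) n (K e : R) : 0 < e ->
  exists M : nat, forall X : nat -> 'M[R]_n,
    (forall j, (j <= M)%N -> `|X j| <= K) ->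
    exists i j, [/\ (i < j)%N, (j <= M)%N & `|X i - X j| <= e].
Proof.
move=> e0; pose N := (Num.truncn ((K + K) / e)).+1.
(* Each entry lies in [-K, K], hence in one of finitely many cells of width [e]; with one matrix
   more than there are cell patterns, two share a pattern. *)
exists #|{: 'M['I_N.+1]_n}| => X XK.
pose cell (Y : 'M[R]_n) : 'M['I_N.+1]_n :=
  \matrix_(a, b) inord (Num.truncn ((Y a b + K) / e)).
have cellP Y Z : `|Y| <= K -> `|Z| <= K -> cell Y = cell Z -> `|Y - Z| <= e.
  move=> YK ZK YZ; apply: mx_norm_le => [|a b]; first exact: ltW.
  have key (W : 'M[R]_n) : `|W| <= K -> 0 <= (W a b + K) / e /\
      (Num.truncn ((W a b + K) / e) < N.+1)%N.
    move=> WK; have := le_trans (mx_norm_entry W a b) WK.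
    rewrite ler_norml => /andP[W1 W2].
    split; first by apply: divr_ge0; [lra|exact: ltW].
    rewrite ltnS ltnW// ltnS; apply: Num.Theory.le_truncn.
    by apply: ler_wpM2r; [rewrite invr_ge0 ltW|lra].
  have [Y0 Y1] := key Y YK; have [Z0 Z1] := key Z ZK.
  have := congr1 (fun C : 'M['I_N.+1]_n => C a b : nat) YZ.
  rewrite !mxE !inordK// => tYZ.
  have /andP[y1 y2] := Num.Theory.truncn_itv Y0.
  have /andP[z1 z2] := Num.Theory.truncn_itv Z0.
  rewrite tYZ in y1 y2.
  set m := Num.truncn _ in y1 y2 z1 z2.
  rewrite -natr1 in y2 z2.
  have d1 : (Y a b - Z a b) / e <= 1.
    rewrite (_ : (Y a b - Z a b) / e = (Y a b + K) / e - (Z a b + K) / e); last ring.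
    lra.
  have d2 : -1 <= (Y a b - Z a b) / e.
    rewrite (_ : (Y a b - Z a b) / e = (Y a b + K) / e - (Z a b + K) / e); last ring.
    lra.
  rewrite ler_pdivrMr// in d1; rewrite ler_pdivlMr// in d2.
  by rewrite ler_norml; lra.
pose F (i : 'I_#|{: 'M['I_N.+1]_n}|.+1) := cell (X i).
have /injectivePn[i [j ij Fij]] : ~~ injectiveb F.
  by apply/negP => /injectiveP /leq_card; rewrite card_ord ltnn.
wlog lij : i j ij Fij / (i < j)%N.
  move=> H; have [|ji|/val_inj/eqP] := ltngtP i j; first exact: H.
  - by apply: (H j i) => //; rewrite eq_sym.
  - by rewrite (negbTE ij).
exists i, j; split; rewrite ?leq_ord//.
by apply: cellP => //; apply: XK; rewrite leq_ord.
Qed.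

(** * Products of a family of matrices *)

(** Words are lists over an arbitrary index type, so that prefixes and factors of a product are list
    operations. *)
Definition lprod (R : realType) (T : Type) n (F : T -> 'M[R]_n) (l : seq T) : 'M[R]_n :=
  \prod_(x <- l) F x.

Lemma lprod_nil (R : realType) (T : Type) n (F : T -> 'M[R]_n) :
  lprod F [::] = 1%:M.
Proof. exact: big_nil. Qed.

Lemma lprod_cat (R : realType) (T : Type) n (F : T -> 'M[R]_n) l1 l2 :
  lprod F (l1 ++ l2) = lprod F l1 *m lprod F l2.
Proof. exact: big_cat. Qed.

Lemma lprod_cons (R : realType) (T : Type) n (F : T -> 'M[R]_n) x l :
  lprod F (x :: l) = F x *m lprod F l.
Proof. exact: big_cons. Qed.

Lemma lprod_scale (R : realType) (T : Type) n (F : T -> 'M[R]_n) (c : R) l :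
  lprod (fun x => c *: F x) l = c ^+ size l *: lprod F l.
Proof.
elim: l => [|x l IH]; first by rewrite !lprod_nil scale1r.
by rewrite !lprod_cons IH -scalemxAl -scalemxAr scalerA exprS.
Qed.

Lemma expr_small (R : realType) (s e : R) : 0 <= s < 1 -> 0 < e ->
  exists m, s ^+ m <= e.
Proof.
move=> /andP[s0 s1] e0.
have /cvgrPdist_le/(_ e e0)[m _ /(_ m (leqnn m))] : (fun m => s ^+ m) @ \oo --> (0 : R).
  by apply: cvg_expr; rewrite ger0_norm.
by rewrite /= sub0r normrN ger0_norm ?exprn_ge0// => sm; exists m.
Qed.

(** Bernoulli's inequality at [x = 1 / (2 L)]: damping by [1 - x] costs at most a factor 2 over [L]
    factors. *)
Lemma bernoulli_half (R : realType) (L : nat) : (0 < L)%N ->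
  2^-1 <= (1 - (2 * L%:R)^-1 : R) ^+ L.
Proof.
move=> L0; have L1 : (1 : R) <= L%:R by rewrite ler1n.
have x1 : (2 * L%:R)^-1 <= (1 : R) by rewrite invf_le1 ?mulr_gt0//; lra.
have x0 : 0 <= (2 * L%:R : R)^-1 by rewrite invr_ge0; lra.
set x : R := (2 * L%:R)^-1 in x0 x1 *.
have bern m : 1 - m%:R * x <= (1 - x) ^+ m.
  elim: m => [|m IH]; first by rewrite mul0r subr0.
  rewrite exprSr; apply: (@le_trans _ _ ((1 - m%:R * x) * (1 - x))).
    by rewrite -natr1; have := mulr_ge0 (mulr_ge0 (ler0n R m) x0) x0; lra.
  by apply: ler_wpM2r => //; lra.
apply: le_trans (bern L).
have -> : L%:R * x = 2^-1 by rewrite /x; field; lra.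
lra.
Qed.

(* If a product of length [L] were large in the basis of [bounded_monoid_conj],
   two of its prefixes [X] and [X Q] would be close while [X] is not small;
   as [\det (1 - Q) *: X = (X - X Q) *m \adj (1 - Q)], this contradicts the
   lower bound on [\det (1 - Q)].  The point is that [s] depends neither on
   the family nor on the bound [K]. *)
Lemma lprod_bounded_step (R : realType) n (N : nat) (d : R) : 0 < d ->
  exists2 s : R, 0 < s < 1 & forall (T : Type) (F : T -> 'M[R]_n),
    (forall l, (N <= size l)%N -> d <= `|\det (1%:M - lprod F l)|) ->
    (exists K : R, forall l, s ^+ size l * `|lprod F l| <= K) ->
    exists K : R, forall l, `|lprod F l| <= K.
Proof.
(* [n.+1] rather than [n] keeps the constant of submultiplicativity positive when [n = 0]. *)
move=> d0; pose k : R := n.+1%:R.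
have k1 : 1 <= k by rewrite ler1n.
have k0 : 0 < k by lra.
have normM (X Y : 'M[R]_n) : `|X *m Y| <= k * `|X| * `|Y|.
  rewrite (le_trans (mx_normM _ _))//; apply: ler_wpM2r => //.
  by apply: ler_wpM2r => //; rewrite ler_nat.
(* Words of length at most [L] will have conjugated products bounded by 4: 2 from the choice of
   basis, divided by 1/2 from the damping. Hence 5 for [1 - Y q]. *)
have [C C0 adjC] := @adj_bound R n 5.
pose e := d / (4 * k ^+ 3 * (C + 1)).
have e0 : 0 < e by rewrite divr_gt0// !mulr_gt0 ?exprn_gt0//; lra.
have [M Mpig] := @bounded_mx_pigeonhole R n 4 e e0.
(* Room for [M.+1] prefixes with lengths the multiples of [N.+1]: the factor between any two of them
   has length at least [N]. *)
pose L := (M * N.+1).+1.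
pose s : R := 1 - (2 * L%:R)^-1.
have L1 : (1 : R) <= L%:R by rewrite ler1n.
have sL : 2^-1 <= s ^+ L by exact: bernoulli_half.
have s01 : 0 < s < 1.
  have : 0 < (2 * L%:R : R)^-1 by rewrite invr_gt0; lra.
  have : (2 * L%:R : R)^-1 <= 2^-1 by rewrite lef_pV2 ?posrE; lra.
  rewrite /s; lra.
have [s0 s1] := andP s01.
have s0' := ltW s0; have s1' := ltW s1.
exists s => // T F detF [K FK].
have [V Vu VS] : exists2 V : 'M[R]_n, V \in unitmx &
    forall l, s ^+ size l * `|invmx V *m lprod F l *m V| <= 2.
  have [|||V Vu VS] := @bounded_monoid_conj R n
      [set s ^+ size l *: lprod F l | l in [set: seq T]] K.
  - by exists [::] => //; rewrite lprod_nil scale1r.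
  - move=> _ _ [l1 _ <-] [l2 _ <-]; exists (l1 ++ l2) => //.
    by rewrite lprod_cat size_cat exprD -scalemxAl -scalemxAr scalerA.
  - by move=> _ [l _ <-]; rewrite normrZ ger0_norm ?exprn_ge0.
  exists V => // l; have := VS _ (ex_intro2 _ _ l I erefl).
  by rewrite -scalemxAr -scalemxAl normrZ ger0_norm ?exprn_ge0.
pose Y l := invmx V *m lprod F l *m V.
have Ycat l1 l2 : Y (l1 ++ l2) = Y l1 *m Y l2.
  rewrite /Y lprod_cat !mulmxA; congr (_ *m _ *m _).
  by rewrite -[RHS]mulmxA mulmxV// mulmx1.
have YL l : (size l <= L)%N -> `|Y l| <= 4.
  move=> lL; have sl : 2^-1 <= s ^+ size l.
    by apply: (le_trans sL); exact: ler_wiXn2l.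
  have := VS l; rewrite -/(Y l) => Yl.
  have := ler_wpM2r (normr_ge0 (Y l)) sl; lra.
(* Since [k] is the constant of [normM], blocks of length [L] can then be peeled off a long word
   without increasing the bound. *)
have small l : size l = L -> k * `|Y l| <= 1.
  move=> szl; rewrite leNgt; apply/negP => big.
  pose X j := Y (take (j * N.+1) l).
  have [i [j [ij jM XX]]] : exists i j, [/\ (i < j)%N, (j <= M)%N & `|X i - X j| <= e].
    by apply: Mpig => j _; apply: YL; rewrite size_take_min szl geq_minr.
  pose q := take ((j - i) * N.+1) (drop (i * N.+1) l).
  have szq : (N <= size q)%N.
    rewrite size_take_min size_drop szl leq_min; apply/andP; split.
      by rewrite (leq_trans (leqnSn N))// leq_pmull// subn_gt0.
    have iM : (i.+1 * N.+1 <= M * N.+1)%N by rewrite leq_mul2r (leq_trans ij jM).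
    rewrite mulSn in iM; rewrite leq_subRL.
      by rewrite addnC (leq_trans _ (leqnSn _))// (leq_trans _ iM)// leq_add2r.
    by rewrite (leq_trans _ (leqnSn _))// (leq_trans _ iM)// leq_addl.
  have XQ : X j = X i *m Y q.
    rewrite -Ycat -takeD -mulnDl subnKC//; exact: ltnW.
  have dQ : d <= `|\det (1%:M - Y q)|.
    have -> : 1%:M - Y q = invmx V *m (1%:M - lprod F q) *m V.
      by rewrite mulmxBr mulmxBl mulmx1 mulVmx.
    rewrite !det_mulmx det_inv mulrAC mulVf ?mul1r ?detF//.
    by rewrite -unitfE -unitmxE.
  have Yq : `|1%:M - Y q| <= 5.
    rewrite (le_trans (ler_normB _ _))//.
    have := @mx_norm1 R n; have : `|Y q| <= 4.
      by apply: YL; rewrite size_take_min size_drop szl geq_min leq_subr orbT.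
    lra.
  (* [Y l] is large and equals [X i] times a factor bounded by 4, so [X i] is not small. *)
  have Xi : 1 < 4 * k ^+ 2 * `|X i|.
    apply: (lt_le_trans big).
    have -> : Y l = X i *m Y (drop (i * N.+1) l) by rewrite -Ycat cat_take_drop.
    have Yd : `|Y (drop (i * N.+1) l)| <= 4.
      by apply: YL; rewrite size_drop szl leq_subr.
    apply: (@le_trans _ _ (k * (k * `|X i| * `|Y (drop (i * N.+1) l)|))).
      by apply: ler_wpM2l; [lra | exact: normM].
    have kX : 0 <= k * (k * `|X i|) by rewrite !mulr_ge0//; lra.
    have := ler_wpM2l kX Yd; rewrite expr2; lra.
  have : `|\det (1%:M - Y q) *: X i| <= k * e * C.
    have -> : \det (1%:M - Y q) *: X i = (X i - X j) *m \adj (1%:M - Y q).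
      rewrite XQ -{2}[X i]mulmx1 -mulmxBr -mulmxA mul_mx_adj -mul_scalar_mx.
      by rewrite scalar_mxC.
    apply: (le_trans (normM _ _)).
    apply: ler_pM => //; last exact: adjC.
      by rewrite mulr_ge0//; lra.
    by apply: ler_wpM2l; [lra | exact: XX].
  rewrite normrZ leNgt => /negP; apply.
  have dX : d * `|X i| <= `|\det (1%:M - Y q)| * `|X i| by exact: ler_wpM2r.
  apply: (lt_le_trans _ dX).
  have keC : k * e * (C + 1) = d / (4 * k ^+ 2).
    by rewrite /e; field; rewrite !gt_eqF//; lra.
  have : k * e * C < k * e * (C + 1).
    by rewrite (ltr_pM2l (mulr_gt0 k0 e0)) ltrDl.
  move/lt_le_trans; apply.
  have k4 : 0 < 4 * k ^+ 2 by apply: mulr_gt0; [lra | exact: exprn_gt0].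
  rewrite keC ler_pdivrMr//.
  have := ler_wpM2l (ltW d0) (ltW Xi); lra.
have bnd m l : (size l <= m)%N -> k * `|Y l| <= 4 * k.
  elim: m l => [|m IH] l lm; have [lL|Ll] := leqP (size l) L.
  - by have := ler_wpM2l (ltW k0) (YL l lL); lra.
  - by have := leq_trans Ll lm.
  - by have := ler_wpM2l (ltW k0) (YL l lL); lra.
  - rewrite -(cat_take_drop L l) Ycat.
    apply: (@le_trans _ _ (k * (k * `|Y (take L l)| * `|Y (drop L l)|))).
      by apply: ler_wpM2l; [lra | exact: normM].
    have sm := small (take L l) (size_takel (ltnW Ll)).
    have dr : k * `|Y (drop L l)| <= 4 * k.
      by apply: IH; rewrite size_drop leq_subLR (leq_trans lm)// /L addSn ltnS leq_addl.
    have := ler_wpM2r (normr_ge0 (Y (drop L l))) sm.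
    have := normr_ge0 (Y (drop L l)) => Y0 /(ler_wpM2l (ltW k0)); lra.
exists (k * (k * `|V| * 4) * `|invmx V|) => l.
have -> : lprod F l = V *m Y l *m invmx V.
  by rewrite /Y -!mulmxA mulmxV// mulmx1 !mulmxA mulmxV// mul1mx.
apply: (le_trans (normM _ _)); apply: ler_wpM2r => //; apply: ler_wpM2l; first lra.
apply: (le_trans (normM _ _)); apply: ler_wpM2l; first by rewrite mulr_ge0//; lra.
by have := bnd (size l) l (leqnn _); rewrite [4 * k]mulrC ler_pM2l.
Qed.

(* Scaling the family down does not increase the spectral radii, so
   [lprod_bounded_step] can be iterated from a contractive multiple of [F]. *)
Lemma lprod_bounded (R : realType) (T : Type) n (F : T -> 'M[R]_n) (N : nat) (b d : R) :
  0 < d -> (forall x, `|F x| <= b) ->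
  (forall (c : R) l, 0 <= c <= 1 -> (N <= size l)%N ->
     d <= `|\det (1%:M - c *: lprod F l)|) ->
  exists K : R, forall l, `|lprod F l| <= K.
Proof.
move=> d0 Fb detF; have [s /andP[s0 s1] step] := lprod_bounded_step n N d0.
have s0' := ltW s0; have s1' := ltW s1.
pose k : R := n.+1%:R * (`|b| + 1).
have k0 : 0 < k by rewrite mulr_gt0// ltr_wpDl.
have [m sm] : exists m, s ^+ m <= k^-1.
  by apply: expr_small; rewrite ?invr_gt0// s1 s0'.
have : exists K : R, forall l, `|lprod (fun x => s ^+ m *: F x) l| <= K.
  exists 1; elim=> [|x l IH]; first by rewrite lprod_nil mx_norm1.
  rewrite lprod_cons (le_trans (mx_normM _ _))//.
  rewrite -[leRHS]mul1r; apply: ler_pM; rewrite ?mulr_ge0//.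
  rewrite normrZ ger0_norm ?exprn_ge0// mulrCA.
  apply: (@le_trans _ _ (k^-1 * k)); last by rewrite mulVf ?gt_eqF.
  apply: ler_pM; rewrite ?mulr_ge0 ?exprn_ge0//.
  apply: ler_pM => //; first by rewrite ler_nat.
  by rewrite (le_trans (Fb x))// (le_trans (ler_norm b))// lerDl.
(* Descend to [s ^+ 0 = 1] one power of [s] at a time; the determinant bound for the family scaled
   by [s ^+ m] is the hypothesis with [c = (s ^+ m) ^+ size l]. *)
elim: m {sm} => [|m IH].
  by move=> [K FK]; exists K => l; have := FK l; rewrite lprod_scale expr0 expr1n scale1r.
move=> [K FK]; apply/IH/step => [l Nl|].
  rewrite lprod_scale; apply: detF => //.
  by rewrite !exprn_ge0 ?exprn_ile1 ?exprn_ge0 ?exprn_ile1.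
exists K => l; have := FK l; rewrite !lprod_scale !normrZ mulrA.
by rewrite exprS exprMn [in X in X -> _]normrM [`|s ^+ size l|]ger0_norm// exprn_ge0.
Qed.

(** * Joint spectral radius *)

Lemma char_poly_horner (R : comNzRingType) n (A : 'M[R]_n) a :
  (char_poly A).[a] = \det (a%:M - A).
Proof.
rewrite /char_poly -horner_evalE -det_map_mx; congr (\det _).
by apply/matrixP => i j; rewrite !mxE /= horner_evalE !hornerE hornerMn hornerX.
Qed.

Lemma spec_rad_poly (R : realType) n (M : 'M[R]_n) :
  exists2 rs : seq R[i],
    char_poly (map_mx (real_complex R) M) = \prod_(l <- rs) ('X - l%:P) &
    size rs = n /\ forall l, l \in rs -> `|l| <= (real_complex R (spec_rad M)).
Proof.
set Mc := map_mx _ M.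
have [rs rsE] := closed_field_poly_normal (char_poly Mc).
rewrite (monicP (char_poly_monic Mc)) scale1r in rsE.
have eigE l : eigenvalue Mc l = (l \in rs).
  by rewrite eigenvalue_root_char rsE root_prod_XsubC.
exists rs => //; split.
  by apply: succn_inj; rewrite -(size_prod_XsubC rs id) -rsE size_char_poly.
move=> l lrs.
have normE : `|l| = real_complex R (complex.Re `|l|) by rewrite normc_def.
rewrite normE lecR; apply: ub_le_sup; last by exists l; rewrite ?eigE.
(* The sum of the moduli of all roots bounds the set, so [sup] is a genuine upper bound. *)
exists (\sum_(l <- rs) complex.Re `|l|) => x [l' + xl].
rewrite eigE => l'rs; rewrite (_ : x = complex.Re `|l'|); last by rewrite -xl.
rewrite (big_rem l')//= lerDl sumr_ge0// => z _.
by case: z => x1 x2 /=; rewrite sqrtr_ge0.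
Qed.

Lemma spec_rad_ge0 (R : realType) n (M : 'M[R]_n) : 0 <= spec_rad M.
Proof.
have [rs _ [szrs rsM]] := spec_rad_poly M.
case: rs szrs rsM => [n0 _|l rs _ /(_ l (mem_head _ _))]; last first.
  by move/(le_trans (normr_ge0 l)); rewrite lecR.
(* There are no roots only for [n = 0]; the supremum of the empty set is then 0. *)
rewrite /spec_rad; set E := (X in sup X); suff -> : E = set0 by rewrite sup0.
apply/seteqP; split => // x [l /eigenvalueP[v _ +] _].
by subst n; rewrite (thinmx0 v) eqxx.
Qed.

(** The determinant is the product of [1 - c * l] over the eigenvalues [l], each factor having
    modulus at least [1 - e]. This turns spectral radii into the bounds that [lprod_bounded]
    takes. *)
Lemma det_sub1_spec_rad (R : realType) n (M : 'M[R]_n) (c e : R) :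
  0 <= c -> 0 <= e <= 1 -> c * spec_rad M <= e ->
  (1 - e) ^+ n <= `|\det (1%:M - c *: M)|.
Proof.
move=> c0 /andP[e0 e1] cM; have [->|cn0] := eqVneq c 0.
  by rewrite scale0r subr0 det1 normr1 exprn_ile1; lra.
have [rs rsE [szrs rsM]] := spec_rad_poly M.
rewrite -lecR.
have -> : real_complex R `|\det (1%:M - c *: M)| =
          `|\prod_(l <- rs) (1 - real_complex R c * l)|.
  have -> : \prod_(l <- rs) (1 - real_complex R c * l) =
            real_complex R (\det (1%:M - c *: M)).
    have cu : c%:M *m (c^-1%:M - M) = 1%:M - c *: M.
      by rewrite mulmxBr -scalar_mxM mulfV// mul_scalar_mx.
    rewrite -cu det_mulmx det_scalar rmorphM -det_map_mx rmorphXn /=.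
    have -> : map_mx (real_complex R) (c^-1%:M - M) =
        (real_complex R c^-1)%:M - map_mx (real_complex R) M.
      by rewrite map_mxB map_scalar_mx.
    rewrite -char_poly_horner rsE horner_prod -szrs.
    elim: (rs) => [|l s IH]; first by rewrite !big_nil mulr1.
    rewrite !big_cons /= exprS IH mulrACA; congr (_ * _).
    by rewrite hornerXsubC mulrBr -rmorphM mulfV// rmorph1.
  by rewrite normc_def /= expr0n addr0 sqrtr_sqr.
rewrite -szrs rmorphXn rmorphB rmorph1 normr_prod.
have e1' : 0 <= 1 - real_complex R e by rewrite subr_ge0 (_ : 1 = real_complex R 1)// lecR.
elim: (rs) rsM {rsE szrs} => [|l s IH] rsM; first by rewrite big_nil.
rewrite big_cons exprS; apply: ler_pM; rewrite ?exprn_ge0//; last first.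
  by apply: IH => l' l's; apply: rsM; rewrite in_cons l's orbT.
have cl : `|real_complex R c * l| <= real_complex R e.
  rewrite normrM ger0_norm ?lecR//.
  apply: (@le_trans _ _ (real_complex R c * real_complex R (spec_rad M))).
    by apply: ler_wpM2l; [rewrite lecR | rewrite rsM ?mem_head].
  by rewrite -rmorphM lecR.
apply: le_trans (lerB_dist _ _).
by rewrite normr1 lerD2l lerN2.
Qed.

Lemma jsr_lt_spec_rad (R : realType) n (A : set 'M[R]_n) (r r' : R) :
  (jsr A <= r%:E)%E -> r < r' -> exists N : nat, forall t Ms,
    (N <= t)%N -> (forall s, (1 <= s <= t)%N -> A (Ms s)) ->
    spec_rad (mxprod Ms t) <= r' ^+ t.
Proof.
move=> Ar rr'; have : (jsr A < r'%:E)%E by rewrite (le_lt_trans Ar)// lte_fin.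
rewrite /jsr /limn_esup /limf_esup => /ereal_inf_lt[_ [V [N _ NV] <-] Vr'].
(* [N.+1] excludes [t = 0], where the [t]-th root cannot be undone. *)
exists N.+1 => t Ms Nt AMs; set x := spec_rad _.
have t0 : (t%:R : R) != 0 by rewrite pnatr_eq0; case: (t) Nt.
have x0 : 0 <= x := spec_rad_ge0 _.
have xr' : x `^ t%:R^-1 <= r'.
  rewrite -lee_fin; apply: le_trans (ltW Vr').
  apply: (@le_trans _ _ (ereal_sup
    [set ((spec_rad (mxprod Ms t)) `^ (t%:R^-1))%:E
    | Ms in [set Ms : nat -> 'M[R]_n | forall s, (1 <= s <= t)%N -> A (Ms s)]])).
    by apply: ereal_sup_ubound; exists Ms.
  by apply: ereal_sup_ubound; exists t => //; apply: NV; exact: ltnW.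
have -> : x = (x `^ t%:R^-1) ^+ t.
  by rewrite -powR_mulrn ?powR_ge0// -powRrM mulVf// powRr1.
by apply: lerXn2r; rewrite ?nnegrE ?powR_ge0// (le_trans (powR_ge0 _ _) xr').
Qed.

Lemma mxprod_lprod (R : realType) (T : Type) n (F : T -> 'M[R]_n) l :
  mxprod (fun s => nth 1%:M (map F l) s.-1) (size l) = lprod F l.
Proof.
rewrite /mxprod /lprod big_add1 /= -(size_map F l) -(big_map F xpredT id).
by rewrite [RHS](big_nth 1%:M).
Qed.

(** Take [r < r' < rho < 1]. After division by [rho], long products have spectral radius at most
    [(r' / rho) ^+ size l], so [lprod_bounded] bounds the rescaled family; scaling back gives the
    decay. *)
Lemma jsr_lprod_decay (R : realType) (T : Type) n (F : T -> 'M[R]_n) (b r : R) :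
  (forall x, `|F x| <= b) -> 0 <= r < 1 -> (jsr (range F) <= r%:E)%E ->
  exists K rho : R, 0 <= rho < 1 /\ forall l, `|lprod F l| <= K * rho ^+ size l.
Proof.
move=> Fb /andP[r0 r1] jF.
pose r' := (r + 1) / 2; pose rho := (r' + 1) / 2.
have rr' : r < r' by rewrite /r'; lra.
have r'0 : 0 < r' by lra.
have r'1 : r' < 1 by rewrite /r'; lra.
have rho0 : 0 < rho by rewrite /rho; lra.
have [N specN] := jsr_lt_spec_rad jF rr'.
pose e := rho^-1 * r'.
have e1 : e < 1 by rewrite /e mulrC ltr_pdivrMr// mul1r /rho; lra.
have e0 : 0 <= e by rewrite mulr_ge0 ?invr_ge0// ltW.
(* [N.+1] makes the words nonempty, whence [e ^+ size l <= e]. *)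
have [|x|c l /andP[c0 c1] Nl|K FK] :=
    @lprod_bounded R T n (fun x => rho^-1 *: F x) N.+1 (rho^-1 * b) ((1 - e) ^+ n).
- by rewrite exprn_gt0// subr_gt0.
- by rewrite normrZ ger0_norm ?invr_ge0 ?(ltW rho0)// ler_wpM2l ?invr_ge0 ?(ltW rho0).
- rewrite lprod_scale scalerA; apply: det_sub1_spec_rad.
  + by rewrite mulr_ge0// exprn_ge0 ?invr_ge0 ?(ltW rho0).
  + by rewrite e0 ltW.
  + have sl : spec_rad (lprod F l) <= r' ^+ size l.
      rewrite -mxprod_lprod; apply: specN; first exact: ltnW.
      move=> s /andP[s1 sl].
      have [x Fx] : exists x, nth 1%:M (map F l) s.-1 = F x.
        elim: l s s1 sl {Nl} => [|x l IH] [|[|s]]//= _ sl; first by exists x.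
        by apply: (IH s.+1).
      by rewrite Fx; exists x.
    apply: (@le_trans _ _ (c * (e ^+ size l))).
      rewrite -mulrA exprMn; apply: ler_wpM2l => //.
      by apply: ler_wpM2l => //; rewrite exprn_ge0 ?invr_ge0 ?(ltW rho0).
    rewrite -[leRHS]mul1r; apply: ler_pM; rewrite ?exprn_ge0//.
    by rewrite -[leRHS]expr1; apply: ler_wiXn2l; rewrite ?(ltW e1)// (leq_trans _ Nl).
- exists K, rho; split; first by rewrite (ltW rho0) /rho /r'; lra.
  move=> l; have := FK l; rewrite lprod_scale normrZ ger0_norm; last first.
    by rewrite exprn_ge0 ?invr_ge0 ?(ltW rho0).
  by rewrite exprVn mulrC ler_pdivrMr// exprn_gt0.
Qed.

(** * Maps with increments in a family of exponentially decaying products *)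

Lemma lipschitz_continuous (R : realType) m n (f : 'cV[R]_m -> 'cV[R]_n) (K : R) :
  (forall x y, `|f x - f y| <= K * `|x - y|) -> continuous f.
Proof.
move=> fK x; have FF : Filter (nbhs x) by exact: nbhs_filter.
apply/cvgrPdist_le => e e0.
have k0 : 0 < `|K| + 1 by rewrite ltr_wpDl.
apply: filterS (nbhsx_ballx x _ (divr_gt0 e0 k0)) => y.
rewrite -ball_normE /= => /ltW xy; apply: (le_trans (fK x y)).
apply: (@le_trans _ _ ((`|K| + 1) * `|x - y|)).
  by apply: ler_wpM2r => //; rewrite (le_trans (ler_norm K))// lerDl.
by rewrite mulrC -ler_pdivlMr.
Qed.

(** Completeness of matrix spaces, for [banach_fixed_point]. *)
HB.instance Definition _ (R : realType) (m n : nat) :=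
  Uniform_isComplete.Build 'M[R]_(m, n) (@cauchy_cvg 'M[R]_(m, n)).

Lemma half_contraction_fixed_point (R : realType) n (g : 'cV[R]_n -> 'cV[R]_n) :
  (forall w w', `|g w - g w'| <= 2^-1 * `|w - w'|) -> exists w, g w = w.
Proof.
move=> gP; pose g' : {fun [set: 'cV[R]_n] >-> [set: 'cV[R]_n]} := [fun of totalfun g].
have ctr : is_contraction g'.
  have h0 : 0 <= (2^-1 : R) by rewrite invr_ge0.
  exists (NngNum h0); split => /=; first by rewrite invf_lt1// ltr1n.
  by move=> -[w w'] _ /=; exact: gP.
have [w _ wE] := banach_fixed_point ctr closedT (ex_intro _ 0 I).
by exists w; rewrite [RHS]wE.
Qed.

Lemma decay_small (R : realType) n (K rho : R) : 0 <= rho < 1 ->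
  exists N : nat, n%:R * (K * rho ^+ N) <= 2^-1.
Proof.
move=> rho01; have k0 : 0 < n%:R * `|K| + 1 by rewrite ltr_wpDl// mulr_ge0.
have [|N sN] := @expr_small R rho (2^-1 / (n%:R * `|K| + 1)) rho01.
  by rewrite divr_gt0.
exists N; rewrite mulrA; move: sN; rewrite ler_pdivlMr// mulrC => sN.
have /andP[r0 _] := rho01; apply: le_trans sN; apply: ler_wpM2r; first exact: exprn_ge0.
apply: (@le_trans _ _ (n%:R * `|K|)); last by rewrite lerDl.
by apply: ler_wpM2l; rewrite ?ler_norm.
Qed.

Lemma decay_fixed_point (R : realType) (T : Type) n (F : T -> 'M[R]_n) (K rho : R)
    (f : 'cV[R]_n -> 'cV[R]_n) :
  0 <= rho < 1 -> (forall l, `|lprod F l| <= K * rho ^+ size l) ->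
  (forall w w', exists x, f w - f w' = F x *m (w - w')) ->
  exists w, f w = w.
Proof.
move=> rho01 FK fF; have [N small] := decay_small n K rho01.
have iterF m w w' : exists2 l, size l = m &
    iter m f w - iter m f w' = lprod F l *m (w - w').
  elim: m => [|m [l lm lE]]; first by exists [::]; rewrite // lprod_nil mul1mx.
  have [x xE] := fF (iter m f w) (iter m f w').
  by exists (x :: l); rewrite /= ?lm// xE lE lprod_cons mulmxA.
have ctr w w' : `|iter N f w - iter N f w'| <= 2^-1 * `|w - w'|.
  have [l lN ->] := iterF N w w'; apply: (le_trans (mx_normM _ _)).
  apply: ler_wpM2r => //; apply: le_trans small.
  by apply: ler_wpM2l => //; rewrite -lN.
have [w wE] := half_contraction_fixed_point ctr.
(* [f w] is also fixed by the [N]-th iterate, which halves distances, so [f w = w]. *)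
exists w; apply/eqP; rewrite -subr_eq0 -normr_le0.
have := ctr (f w) w; rewrite -iterSr iterS wE; lra.
Qed.

(** Unroll the equation [N] times: the coefficient of [w] becomes a product of length [N], and the
    resulting half of the norm of [w] is absorbed on the left. [N] does not depend on [x], so
    neither does [C]. *)
Lemma decay_solution_bound (R : realType) (T : Type) n (F : T -> 'M[R]_n) (K rho : R) :
  0 <= rho < 1 -> (forall l, `|lprod F l| <= K * rho ^+ size l) ->
  exists2 C : R, 0 <= C & forall x (w e : 'cV[R]_n),
    w = F x *m w + e -> `|w| <= C * `|e|.
Proof.
move=> rho01 FK; have [N small] := decay_small n K rho01.
have /andP[r0 r1] := rho01.
exists (2 * (n%:R * (N%:R * `|K|))) => [|x w e we]; first by rewrite !mulr_ge0.
pose P j := lprod F (nseq j x).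
have PS j : P j.+1 = P j *m F x.
  by rewrite /P -addn1 nseqD lprod_cat lprod_cons lprod_nil mulmx1.
have wP j : w = P j *m w + (\sum_(i < j) P i) *m e.
  elim: j => [|j IH]; first by rewrite big_ord0 mul0mx addr0 /P lprod_nil mul1mx.
  by rewrite {1}IH {1}we big_ord_recr /= PS mulmxDr mulmxDl mulmxA -addrA [P j *m e + _]addrC.
have PN : `|P N *m w| <= 2^-1 * `|w|.
  apply: (le_trans (mx_normM _ _)); apply: ler_wpM2r => //; apply: le_trans small.
  by apply: ler_wpM2l => //; have := FK (nseq N x); rewrite size_nseq.
have PK j : `|P j| <= `|K|.
  have := FK (nseq j x); rewrite size_nseq => /le_trans; apply.
  apply: (@le_trans _ _ (`|K| * rho ^+ j)).
    by apply: ler_wpM2r; rewrite ?exprn_ge0// ler_norm.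
  by rewrite ler_piMr// exprn_ile1// ltW.
have Pe : `|(\sum_(i < N) P i) *m e| <= n%:R * (N%:R * `|K|) * `|e|.
  apply: (le_trans (mx_normM _ _)); apply: ler_wpM2r => //; apply: ler_wpM2l => //.
  apply: (le_trans (ler_norm_sum _ _ _)).
  apply: (@le_trans _ _ (\sum_(i < N) `|K|)); first by apply: ler_sum => i _; exact: PK.
  by rewrite sumr_const card_ord mulr_natl.
have := ler_normD (P N *m w) ((\sum_(i < N) P i) *m e).
by rewrite -wP -mulrA; lra.
Qed.

(** * Block vectors *)

Lemma nth_allpairs (S T : Type) (s : seq S) (t : seq T) x0 y0 a j :
  (a < size s)%N -> (j < size t)%N ->
  nth (x0, y0) [seq (x, y) | x <- s, y <- t] (a * size t + j) =
  (nth x0 s a, nth y0 t j).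
Proof.
elim: s a => [//|x s IH] [|a] /= sa tj; rewrite nth_cat size_map.
  by rewrite add0n tj (nth_map y0).
by rewrite mulSn -addnA -[X in (_ < X)%N]addn0 ltn_add2l ltn0 addKn IH.
Qed.

(** [Dmat], [Emat] and [Irow] compare indices as naturals; the position comes from the lexicographic
    enumeration of pairs. *)
Lemma mxvec_index_val m n (i : 'I_m) (j : 'I_n) :
  mxvec_index i j = (i * n + j)%N :> nat.
Proof.
rewrite /mxvec_index /=.
have ijP : (i * n + j < #|{: 'I_m * 'I_n}|)%N.
  by rewrite card_prod !card_ord; case: i j => i /= im [j /= jn]; nia.
suff -> : enum_rank (i, j) = Ordinal ijP by [].
apply: enum_val_inj; rewrite enum_rankK (enum_val_nth (i, j)) /=.
have -> : enum {: 'I_m * 'I_n} = [seq (x, y) | x <- enum 'I_m, y <- enum 'I_n].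
  by rewrite enumT unlock.
by rewrite -[X in (i * X + j)%N](size_enum_ord n) nth_allpairs ?size_enum_ord// !nth_ord_enum.
Qed.

Section Stack.
Variables (R : realType) (m p : nat).
Implicit Types v : nat -> 'cV[R]_p.

Lemma bstackE v (a : 'I_m) (j : 'I_p) : bstack m v (mxvec_index a j) 0 = v a j 0.
Proof. by rewrite /bstack mxE mxvecE mxE. Qed.

Lemma eq_bstack v v' : (forall a, (a < m)%N -> v a = v' a) -> bstack m v = bstack m v'.
Proof.
by move=> vv'; apply/colP => k; case/mxvec_indexP: k => a j; rewrite !bstackE vv'.
Qed.

(** Setting the block past the end to 0 lets [Dmat_bstack] treat the last block like the others. *)
Lemma bstackP (y : 'cV[R]_(m * p)) : exists2 v, v m = 0 & y = bstack m v.
Proof.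
exists (fun a => if insub a is Some a' then \col_j y (mxvec_index (a' : 'I_m) j) 0 else 0).
  by rewrite insubF// ltnn.
by apply/colP => k; case/mxvec_indexP: k => a j; rewrite bstackE valK mxE.
Qed.

Lemma bstackD v v' : bstack m v + bstack m v' = bstack m (fun a => v a + v' a).
Proof.
by apply/colP => k; case/mxvec_indexP: k => a j; rewrite mxE !bstackE mxE.
Qed.

Lemma bstackB v v' : bstack m v - bstack m v' = bstack m (fun a => v a - v' a).
Proof.
by apply/colP => k; case/mxvec_indexP: k => a j; rewrite mxE [X in _ + X]mxE !bstackE !mxE.
Qed.

Lemma sum_mxvec_index (G : 'I_(m * p) -> R) :
  \sum_k G k = \sum_(a < m) \sum_(j < p) G (mxvec_index a j).
Proof. by rewrite pair_big (reindex _ (curry_mxvec_bij _ _)) /=; apply: eq_bigr => -[]. Qed.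

Lemma Irow_bstack v : Irow m p *m bstack m v = \sum_(a < m) v a.
Proof.
apply/colP => i; rewrite mxE sum_mxvec_index summxE; apply: eq_bigr => a _.
rewrite (bigD1 i)//= big1 ?addr0.
  by rewrite !mxE mxvec_index_val modnMDl modn_small// eqxx mul1r -bstackE mxE.
move=> j ji; rewrite mxE mxvec_index_val modnMDl modn_small//.
by rewrite (_ : (_ == _) = false) ?mul0r//; exact: negbTE.
Qed.

Lemma sum_delta_nat N (x : 'I_N -> R) (k0 : 'I_N) :
  \sum_(k < N) ((k : nat) == k0)%:R * x k = x k0.
Proof.
rewrite (bigD1 k0)//= eqxx mul1r big1 ?addr0// => k kk0.
by rewrite (_ : (_ == _) = false) ?mul0r//; exact: negbTE.
Qed.

Lemma Emat_bstack v : v m = 0 -> (Emat m p)^T *m bstack m v = v 0%N.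
Proof.
have [m0 vm|m0 _] := posnP m.
  apply/colP => i; rewrite mxE big1 -?{2}m0 ?vm ?mxE// => k _.
  by have := ltn_ord k; rewrite {2}m0.
apply/colP => i; rewrite mxE.
rewrite -[RHS](bstackE _ (Ordinal m0)) -(sum_delta_nat (fun k => bstack m v k 0)).
by apply: eq_bigr => k _; rewrite !mxE mxvec_index_val.
Qed.

Lemma Dmat_bstack v : v m = 0 ->
  Dmat m p *m bstack m v = bstack m (fun a => v a.+1 - v a).
Proof.
move=> vm; apply/colP => k; case/mxvec_indexP: k => a j; rewrite bstackE !mxE.
(* As [p > 0], the diagonal and the shifted diagonal are disjoint, so a row of [Dmat] is a
   difference of two indicators. *)
have p0 : (0 < p)%N by case: (p) j => [[]|].
set k0 := mxvec_index a j.
have -> : \sum_(k < m * p) Dmat m p k0 k * bstack m v k 0 =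
    \sum_(k < m * p) ((k : nat) == (k0 + p)%N)%:R * bstack m v k 0
    - \sum_(k < m * p) ((k : nat) == k0)%:R * bstack m v k 0.
  rewrite -sumrB; apply: eq_bigr => k _; rewrite -mulrBl mxE; congr (_ * _).
  rewrite -val_eqE /= eq_sym; case: eqVneq => [->|_].
    by rewrite (_ : (_ == _) = false) ?sub0r//; lia.
  by rewrite subr0; case: eqP.
rewrite sum_delta_nat bstackE; congr (_ - _).
have [am|ma] := ltnP a.+1 m.
  rewrite -[v a.+1](_ : v (Ordinal am) = _)// -bstackE -(sum_delta_nat (fun k => bstack m v k 0)).
  apply: eq_bigr => k _; rewrite !mxvec_index_val /= mulSn.
  by congr (_%:R * _); apply/eqP/eqP; lia.
have -> : a.+1 = m by apply/eqP; rewrite eqn_leq ma ltn_ord.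
rewrite vm mxE big1// => k _; rewrite (_ : (_ == _) = false) ?mul0r//.
apply/eqP => kE; have := ltn_ord k; rewrite kE ltnNge => /negP; apply.
rewrite mxvec_index_val (leq_trans (leq_mul ma (leqnn p)))// mulSn; lia.
Qed.

(* Summing the block rows of [D y] telescopes to minus its first block. *)
Lemma Emat_Irow_Dmat (y : 'cV[R]_(m * p)) :
  (Emat m p)^T *m y = - (Irow m p *m (Dmat m p *m y)).
Proof.
have [v vm ->] := bstackP y.
rewrite Emat_bstack// Dmat_bstack// Irow_bstack.
by rewrite -(big_mkord xpredT (fun a => v a.+1 - v a)) telescope_sumr// vm sub0r opprK.
Qed.

End Stack.

(** The row space of [al^T] lies in the kernel of [perp] and both have dimension [r], so they agree;
    [L] exists as [perp^T] has full row rank. *)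
Lemma perp_decomposition (R : realType) q r (al : 'M[R]_(q + r, r)) (perp : 'M[R]_(q + r, q)) :
  \rank al = r -> \rank perp = q -> perp^T *m al = 0 ->
  exists2 L : 'M[R]_(q + r, q), perp^T *m L = 1%:M &
    forall y : 'cV_(q + r), perp^T *m y = 0 -> exists v, y = al *m v.
Proof.
move=> ral rperp orth; exists (pinvmx perp^T).
  by apply: mulmxVp; rewrite /row_free mxrank_tr rperp.
move=> y y0.
have alker : (al^T <= kermx perp)%MS.
  by apply/sub_kermxP; rewrite -[perp]trmxK -trmx_mul orth trmx0.
have keral : (kermx perp <= al^T)%MS.
  have /leqifP := mxrank_leqif_sup alker.
  by rewrite mxrank_tr ral mxrank_ker rperp addKn; case: ifP => // _; rewrite ltnn.
have : (y^T <= al^T)%MS.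
  apply: submx_trans keral; apply/sub_kermxP.
  by rewrite -[perp]trmxK -trmx_mul y0 trmx0.
by case/submxP => v yv; exists v^T; rewrite -[y]trmxK yv trmx_mul trmxK.
Qed.

Lemma norm_col_mx (R : realType) m n (x : 'cV[R]_m) (y : 'cV[R]_n) :
  `|col_mx x y| <= `|x| + `|y|.
Proof.
apply: mx_norm_le => [|i j]; first by rewrite addr_ge0.
rewrite !mxE; case: splitP => l _; rewrite (le_trans (mx_norm_entry _ _ _))//.
  by rewrite lerDl.
by rewrite lerDr.
Qed.

Lemma norm_usubmx (R : realType) m n (x : 'cV[R]_(m + n)) : `|usubmx x| <= `|x|.
Proof. by apply: mx_norm_le => // i j; rewrite mxE mx_norm_entry. Qed.

Lemma norm_dsubmx (R : realType) m n (x : 'cV[R]_(m + n)) : `|dsubmx x| <= `|x|.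
Proof. by apply: mx_norm_le => // i j; rewrite mxE mx_norm_entry. Qed.

(** * Equations with increments in a jointly stable family *)

Section Incremental.
Variables (R : realType) (N n : nat) (A : 'M[R]_(N, n)) (B : set 'M[R]_(N, n)).
Variables (bbar rhobar : R) (Th : 'cV[R]_N -> 'cV[R]_n).
Hypothesis B_bounded : forall b, B b -> `|b| <= bbar.
Hypothesis rhobar01 : 0 <= rhobar < 1.
Hypothesis jsrB : (jsr [set (1%:M + b^T *m A)%R | b in B] <= rhobar%:E)%E.
Hypothesis ThB : forall Z Z', exists2 b, B b & Th Z - Th Z' = b^T *m (Z - Z').

Let F (x : {b | B b}) : 'M[R]_n := 1%:M + (proj1_sig x)^T *m A.

Lemma incremental_decay : exists K rho : R,
  0 <= rho < 1 /\ forall l, `|lprod F l| <= K * rho ^+ size l.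
Proof.
apply: (@jsr_lprod_decay R _ n F (1 + N%:R * bbar * `|A|) rhobar) => //.
  move=> [b Bb]; rewrite /F /= (le_trans (ler_normD _ _))// lerD ?mx_norm1//.
  rewrite (le_trans (mx_normM _ _))// mx_norm_tr ler_wpM2r// ler_wpM2l//.
  exact: B_bounded.
suff -> : range F = [set (1%:M + b^T *m A)%R | b in B] by [].
apply/seteqP; split => [_ [[b Bb] _ <-]|_ [b Bb <-]]; first by exists b.
by exists (exist _ b Bb).
Qed.

(** A solution is a fixed point of [W + Th (Z + A *m W) - e], whose increments are
    [(1 + b^T A) (W - W')]. *)
Lemma incremental_solvable Z e : exists W, Th (Z + A *m W) = e.
Proof.
have [K [rho [rho01 FK]]] := incremental_decay.
have [|W WE] := @decay_fixed_point R _ n F K rho (fun W => W + Th (Z + A *m W) - e) rho01 FK.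
  move=> W W'; have [b Bb bE] := ThB (Z + A *m W) (Z + A *m W').
  exists (exist _ b Bb); rewrite /F /= mulmxDl mul1mx -mulmxA mulmxBr.
  have -> : A *m W - A *m W' = Z + A *m W - (Z + A *m W') by rewrite opprD addrACA subrr add0r.
  by rewrite -bE [in LHS]opprB addrA subrK opprD addrACA.
by exists W; apply/eqP; rewrite -subr_eq0; apply/eqP/(@addrI _ W); rewrite addr0 addrA.
Qed.

(** [W - W'] solves a linear equation with matrix [1 + b^T A] and a right-hand side controlled by
    the data; [decay_solution_bound] is uniform in [b]. *)
Lemma incremental_lipschitz : exists2 C : R, 0 <= C & forall Z Z' W W',
  `|W - W'| <= C * (`|Z - Z'| + `|Th (Z + A *m W) - Th (Z' + A *m W')|).
Proof.
have [K [rho [rho01 FK]]] := incremental_decay.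
have [C C0 CP] := decay_solution_bound rho01 FK.
exists (C * (N%:R * `|bbar| + 1)) => [|Z Z' W W'].
  by rewrite mulr_ge0// addr_ge0// mulr_ge0.
have [b Bb bE] := ThB (Z + A *m W) (Z' + A *m W'); set d := Th _ - _ in bE *.
have dE : d = b^T *m (Z - Z') + b^T *m (A *m (W - W')).
  by rewrite bE -mulmxDr (mulmxBr A) opprD addrACA.
have WE : W - W' = F (exist _ b Bb) *m (W - W') + (b^T *m (Z - Z') - d).
  have -> : b^T *m (Z - Z') - d = - (b^T *m (A *m (W - W'))).
    by rewrite dE opprD addrA subrr sub0r.
  by rewrite /F /= mulmxDl mul1mx -mulmxA addrK.
rewrite -mulrA; apply: (le_trans (CP _ _ _ WE)); apply: ler_wpM2l => //.
apply: (le_trans (ler_normB _ _)).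
have Zb : `|b^T *m (Z - Z')| <= N%:R * `|bbar| * `|Z - Z'|.
  apply: (le_trans (mx_normM _ _)); apply: ler_wpM2r => //; apply: ler_wpM2l => //.
  by rewrite mx_norm_tr (le_trans (B_bounded Bb))// ler_norm.
have : 0 <= N%:R * `|bbar| * `|d| by rewrite !mulr_ge0.
have := normr_ge0 (Z - Z'); lra.
Qed.

End Incremental.

(** * The nonlinear VAR *)

Section Blocks.
Variables (R : realType) (p r m : nat) (al : 'M[R]_(p, r)).

Lemma D0mat_col (x : 'cV[R]_p) (y : 'cV[R]_(m * p)) :
  D0mat p r m *m col_mx x y = col_mx 0 (Dmat m p *m y).
Proof. by rewrite /D0mat mul_block_col !mul0mx addr0 add0r. Qed.

Lemma bold_alpha_col (v : 'cV[R]_r) (y : 'cV[R]_(m * p)) :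
  bold_alpha m al *m col_mx v y = col_mx (al *m v + (Emat m p)^T *m y) y.
Proof. by rewrite /bold_alpha mul_block_col mul0mx add0r mul1mx. Qed.

End Blocks.

Lemma S_chiT_col (R : realType) q r m (perp : 'M[R]_(q + r, q)) (x : 'cV[R]_r)
    (y : 'cV[R]_(m * (q + r))) :
  S_chiT m perp *m col_mx x y = col_mx (- (perp^T *m (Irow m (q + r) *m y))) x.
Proof.
rewrite /S_chiT -mulmxA mul_block_col !mul0mx add0r mul1mx addr0.
by rewrite mul_block_col !mul0mx addr0 add0r mul1mx mulNmx.
Qed.

Section Model.
Variables (R : realType) (p m : nat) (f : nat -> 'cV[R]_p -> 'cV[R]_p).
Local Notation g := (gj m.+1 f).

Lemma gj_last w : g m.+1 w = 0.
Proof. by rewrite /gj big_geq// oppr0. Qed.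

Lemma gj_succ i w : (i <= m)%N -> f i.+1 w = g i.+1 w - g i w.
Proof. by move=> im; rewrite /gj [X in _ - - X]big_ltn// opprK addrC addrK. Qed.

Lemma gj0 w : - g 0 w = pimap m.+1 f w + f 0%N w.
Proof. by rewrite /gj /pimap opprK addrAC addNr add0r. Qed.

Lemma Irow_boldg w : Irow m p *m boldg m.+1 f w = \sum_(1 <= i < m.+1) g i w.
Proof. by rewrite Irow_bstack big_add1 big_mkord. Qed.

Lemma hmapE w : hmap m.+1 f w = f 0%N w - Irow m p *m boldg m.+1 f w.
Proof. by rewrite Irow_boldg. Qed.

Lemma Dmat_boldg_solvable w : exists y, Dmat m p *m y = - boldg m.+1 f w.
Proof.
(* The witness is the value of the stacked [zeta] along the path constantly equal to [w]. *)
exists (bstack m (fun a => \sum_(a.+1 <= i < m.+1) g i w)).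
rewrite Dmat_bstack; last by rewrite big_geq.
rewrite /boldg -[RHS]add0r -[0 in RHS](_ : bstack m (fun=> 0) = 0).
  rewrite bstackB; apply: eq_bstack => a am.
  by rewrite [X in _ - X]big_ltn// opprD addrC addrNK sub0r.
by rewrite -[fun=> 0](_ : (fun a : nat => 0 - 0) = _) -?bstackB ?subrr.
Qed.

Variable z : int -> 'cV[R]_p.
Local Notation zet := (zeta m.+1 f z).

Lemma zeta_last t : zet m.+1 t = 0.
Proof. by rewrite /zeta big_geq. Qed.

Lemma zeta_succ a t : (a < m)%N -> zet a.+1 t = g a.+1 (z t) + zet a.+2 (t - 1).
Proof.
move=> am; rewrite /zeta big_ltn//; congr (g _ (z _) + _); first lia.
by apply: eq_bigr => i _; congr (g _ (z _)); lia.
Qed.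

Lemma Emat_bzeta t : (Emat m p)^T *m bzeta m.+1 f z t = zet 1 t.
Proof. by rewrite /bzeta Emat_bstack// zeta_last. Qed.

(** The blocks of [Dmat] above the diagonal encode the recursion [zeta_succ]; the last block uses
    [zeta_last]. *)
Lemma Dmat_bzeta t :
  boldg m.+1 f (z t) + Dmat m p *m bzeta m.+1 f z (t - 1) =
  bzeta m.+1 f z t - bzeta m.+1 f z (t - 1).
Proof.
rewrite /bzeta Dmat_bstack ?zeta_last// bstackD bstackB.
by apply: eq_bstack => a am; rewrite (zeta_succ t am) addrA.
Qed.

Lemma bxiE r (mu : 'cV[R]_r) (th : 'cV[R]_p -> 'cV[R]_r) t :
  bxi m.+1 f mu th z t =
  col_mx (mu + th (z t)) (bzeta m.+1 f z t - bzeta m.+1 f z (t - 1)).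
Proof. by rewrite /bxi /bold_theta D0mat_col !add_col_mx add0r addr0 Dmat_bzeta. Qed.

(* Summation by parts, using [f_i = g_i - g_{i-1}] and [g_k = 0]. *)
Lemma var_increment (c : 'cV[R]_p) (u : int -> 'cV[R]_p) t :
  f 0%N (z t) = c + \sum_(1 <= i < m.+2) f i (z (t - i%:Z)) + u t ->
  f 0%N (z t) - f 0%N (z (t - 1)) =
  c + pimap m.+1 f (z (t - 1)) + u t + (zet 1 (t - 1) - zet 1 (t - 1 - 1)).
Proof.
have sumf : \sum_(1 <= i < m.+2) f i (z (t - i%:Z)) =
    zet 1 (t - 1) - zet 1 (t - 1 - 1) + (pimap m.+1 f (z (t - 1)) + f 0%N (z (t - 1))).
  rewrite big_add1 /=.
  have -> : \sum_(0 <= i < m.+1) f i.+1 (z (t - i.+1%:Z)) =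
      \sum_(0 <= i < m.+1) (g i.+1 (z (t - i.+1%:Z)) - g i (z (t - i.+1%:Z))).
    by apply: eq_big_nat => i /andP[_ im]; rewrite gj_succ.
  (* Boundary terms: the last term of the first sum vanishes, and the first term of the second is
     [- g 0], that is [pimap] plus [f 0]. *)
  rewrite sumrB -gj0 big_nat_recr//= gj_last addr0 [X in _ - X]big_ltn//.
  have -> : \sum_(0 <= i < m) g i.+1 (z (t - i.+1%:Z)) = zet 1 (t - 1).
    by rewrite /zeta big_add1 /=; apply: eq_big_nat => i _; congr (g _ (z _)); lia.
  have -> : \sum_(1 <= i < m.+1) g i (z (t - i.+1%:Z)) = zet 1 (t - 1 - 1).
    by rewrite /zeta; apply: eq_bigr => i _; congr (g _ (z _)); lia.
  by rewrite opprD [- _ - _]addrC addrA.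
by move=> ->; rewrite sumf; move: (zet _ _) (zet _ _) (pimap _ _ _) (u t) (f _ _) =>
  a b d e h; apply/colP => i; rewrite !mxE; ring.
Qed.

End Model.

(** * Inversion of [chi] *)

Section Chi.
Variables (R : realType) (q r m : nat).
Local Notation p := (q + r)%N.
Variables (f : nat -> 'cV[R]_(q + r) -> 'cV[R]_(q + r)) (f0inv : 'cV[R]_(q + r) -> 'cV[R]_(q + r)).
Variables (al : 'M[R]_(q + r, r)) (perp : 'M[R]_(q + r, q)) (th : 'cV[R]_(q + r) -> 'cV[R]_r).
Variables (B : set 'M[R]_(q + r + m * (q + r), r + m * (q + r))) (bbar rhobar : R).

Definition bold_map (Z : 'cV[R]_(q + r + m * (q + r))) : 'cV[R]_(r + m * (q + r)) :=
  bold_theta m.+1 f th (f0inv (usubmx Z)) + D0mat (q + r) r m *m Z.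

Lemma bold_map_col x y :
  bold_map (col_mx x y) = col_mx (th (f0inv x)) (boldg m.+1 f (f0inv x) + Dmat m (q + r) *m y).
Proof. by rewrite /bold_map col_mxKu D0mat_col add_col_mx addr0. Qed.

Hypothesis al_rank : \rank al = r.
Hypothesis f0_homeo : homeo (f 0%N) f0inv.
Hypothesis B_bounded : forall b, B b -> `|b| <= bbar.
Hypothesis rhobar01 : 0 <= rhobar < 1.
Hypothesis jsrB : (jsr [set (1%:M + b^T *m bold_alpha m al)%R | b in B] <= rhobar%:E)%E.
Hypothesis bold_mapB : forall Z Z',
  exists2 b, B b & bold_map Z - bold_map Z' = b^T *m (Z - Z').
Hypothesis perp_rank : \rank perp = q.
Hypothesis perp_al : perp^T *m al = 0.

(** No continuity of [th] or of the [g_i] is assumed: composed with [f0inv] they are components of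
    [bold_map], which is Lipschitz because [B] is bounded. *)
Lemma chi_continuous : continuous (chi m.+1 f perp th).
Proof.
have [f0K _ f0c _] := f0_homeo.
pose Phi (x : 'cV[R]_p) : 'cV[R]_p := col_mx
  (perp^T *m (x - Irow m p *m dsubmx (bold_map (col_mx x 0)))) (usubmx (bold_map (col_mx x 0))).
have -> : chi m.+1 f perp th = Phi \o f 0%N.
  apply/funext => w; rewrite /chi /Phi /= bold_map_col f0K mulmx0 addr0.
  by rewrite col_mxKu col_mxKd hmapE.
suff [K PhiK] : exists K : R, forall x y, `|Phi x - Phi y| <= K * `|x - y|.
  by move=> w; apply: continuous_comp; [exact: f0c | exact: (lipschitz_continuous PhiK)].
pose N : R := (p + m * p)%:R * bbar.
have bmapN x y : `|bold_map (col_mx x 0) - bold_map (col_mx y 0)| <= N * `|x - y|.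
  have [b Bb ->] := bold_mapB (col_mx x 0) (col_mx y 0).
  rewrite opp_col_mx add_col_mx subrr; apply: (le_trans (mx_normM _ _)).
  rewrite mx_norm_tr; apply: ler_pM; rewrite ?mulr_ge0//.
    by apply: ler_wpM2l => //; exact: B_bounded.
  by rewrite (le_trans (norm_col_mx _ _))// normr0 addr0.
exists (p%:R * `|perp| * (1 + (m * p)%:R * `|Irow m p : 'M[R]_(p, m * p)| * N) + N) => x y.
rewrite /Phi opp_col_mx add_col_mx; apply: (le_trans (norm_col_mx _ _)).
rewrite mulrDl; apply: lerD; last first.
  by rewrite -linearB (le_trans (norm_usubmx _)).
rewrite -mulmxBr (le_trans (mx_normM _ _))// mx_norm_tr -[leRHS]mulrA.
apply: ler_wpM2l; first by rewrite mulr_ge0.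
rewrite opprD addrACA -opprD -mulmxBr mulrDl mul1r.
apply: (le_trans (ler_normB _ _)); apply: lerD => //.
apply: (le_trans (mx_normM _ _)); rewrite -[leRHS]mulrA; apply: ler_wpM2l; first by rewrite mulr_ge0.
by rewrite -linearB (le_trans (norm_dsubmx _)).
Qed.

(* [chi w = c] iff [(f_0 w, y)] solves [perp^T (x - E^T y) = usubmx c],
   [bold_map (x, y) = (dsubmx c, 0)] for some [y]; parametrizing the solutions
   of the first equation as [(L (usubmx c), 0) + bold_alpha W] turns the second
   into a problem covered by [incremental_solvable]. *)
Lemma chi_homeo : exists chiinv, homeo (chi m.+1 f perp th) chiinv.
Proof.
have [f0K f0invK _ f0ic] := f0_homeo.
have [L perpL perpker] := perp_decomposition al_rank perp_rank perp_al.
pose A := bold_alpha m al.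
pose Z0 (c : 'cV[R]_p) : 'cV[R]_(p + m * p) := col_mx (L *m usubmx c) 0.
pose e (c : 'cV[R]_p) : 'cV[R]_(r + m * p) := col_mx (dsubmx c) 0.
have [W WE] := choice (fun c =>
  incremental_solvable B_bounded rhobar01 jsrB bold_mapB (Z0 c) (e c)).
have [C C0 Wlip] := incremental_lipschitz B_bounded rhobar01 jsrB bold_mapB.
pose Psi c := usubmx (Z0 c + A *m W c).
have ZW c v y : Z0 c + A *m col_mx v y =
    col_mx (L *m usubmx c + al *m v + (Emat m p)^T *m y) y.
  by rewrite /Z0 /A bold_alpha_col add_col_mx add0r addrA.
have EI y w : Dmat m p *m y = - boldg m.+1 f w ->
    (Emat m p)^T *m y = Irow m p *m boldg m.+1 f w.
  by move=> yE; rewrite Emat_Irow_Dmat yE mulmxN opprK.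
exists (f0inv \o Psi); split.
- move=> w /=; set c := chi _ _ _ _ w; rewrite -[RHS]f0K; congr f0inv.
  have [y yE] := Dmat_boldg_solvable m f w.
  have [|v vE] := perpker (hmap m.+1 f w - L *m usubmx c).
    by rewrite mulmxBr mulmxA perpL mul1mx /c /chi col_mxKu subrr.
  have ZE : Z0 c + A *m col_mx v y = col_mx (f 0%N w) y.
    by rewrite ZW -vE (EI y w yE) hmapE [L *m _ + _]addrC !subrK.
  have bZ : bold_map (Z0 c + A *m col_mx v y) = e c.
    by rewrite ZE bold_map_col f0K yE subrr /e /c /chi col_mxKd.
  (* Uniqueness: both arguments give the same value over the same base point, so the Lipschitz bound
     forces them to be equal. *)
  have := Wlip (Z0 c) (Z0 c) (W c) (col_mx v y); rewrite WE bZ.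
  rewrite !subrr !normr0 addr0 mulr0 normr_le0 subr_eq0 => /eqP Wc.
  by rewrite /Psi Wc ZE col_mxKu.
- move=> c /=; have := WE c; rewrite /Psi -[W c]vsubmxK ZW.
  set v := usubmx _; set y := dsubmx _; set x := _ + _ + _.
  rewrite bold_map_col col_mxKu /e; set w := f0inv x => /eq_col_mx[thw gw].
  have yE : Dmat m p *m y = - boldg m.+1 f w by apply/eqP; rewrite -addr_eq0 addrC gw.
  rewrite /chi thw hmapE f0invK /x (EI y w yE) addrK mulmxDr !mulmxA perpL perp_al.
  by rewrite mul1mx mul0mx addr0 vsubmxK.
- exact: chi_continuous.
- suff [K PsiK] : exists K : R, forall c c', `|Psi c - Psi c'| <= K * `|c - c'|.
    by move=> c; apply: continuous_comp; [exact: (lipschitz_continuous PsiK) | exact: f0ic].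
  have Z0K c c' : `|Z0 c - Z0 c'| <= q%:R * `|L| * `|c - c'|.
    rewrite /Z0 opp_col_mx add_col_mx subrr (le_trans (norm_col_mx _ _))// normr0 addr0.
    rewrite -mulmxBr -linearB (le_trans (mx_normM _ _))// ler_wpM2l ?mulr_ge0//.
    exact: norm_usubmx.
  have eK c c' : `|e c - e c'| <= `|c - c'|.
    rewrite /e opp_col_mx add_col_mx subrr (le_trans (norm_col_mx _ _))// normr0 addr0.
    by rewrite -linearB norm_dsubmx.
  pose k : R := (r + m * p)%:R * `|A|.
  exists (q%:R * `|L| + k * (C * (q%:R * `|L| + 1))) => c c'.
  rewrite /Psi -linearB (le_trans (norm_usubmx _))// opprD addrACA -mulmxBr mulrDl.
  apply: (le_trans (ler_normD _ _)); apply: lerD => //.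
  apply: (le_trans (mx_normM _ _)); rewrite -[leRHS]mulrA; apply: ler_wpM2l; first by rewrite mulr_ge0.
  have := Wlip (Z0 c) (Z0 c') (W c) (W c'); rewrite !WE => /le_trans; apply.
  rewrite -[leRHS]mulrA; apply: ler_wpM2l => //; rewrite mulrDl mul1r; exact: lerD.
Qed.

End Chi.

(* p = q + r with q >= 1 (i.e. r in {0,...,p-1}); k >= 1. *)
Theorem theorem3p1 (R : realType) (q r k : nat) (hq : (0 < q)%N) (hk : (0 < k)%N)
  (c : 'cV[R]_(q + r)) (f : nat -> 'cV[R]_(q + r) -> 'cV[R]_(q + r))
  (f0inv : 'cV[R]_(q + r) -> 'cV[R]_(q + r))
  (al : 'M[R]_(q + r, r)) (mu : 'cV[R]_r) (th : 'cV[R]_(q + r) -> 'cV[R]_r)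
  (B : set 'M[R]_(q + r + k.-1 * (q + r), r + k.-1 * (q + r)))
  (bbar rhobar : R) (alperp : 'M[R]_(q + r, q))
  (z u : int -> 'cV[R]_(q + r)) :
  (* f_i(0) = 0 *)
  (forall i, (i <= k)%N -> f i 0 = 0) ->
  (* alpha of rank r *)
  \rank al = r ->
  (* (i) f_0 is a homeomorphism of R^p, with inverse f0inv *)
  homeo (f 0%N) f0inv ->
  (* (ii) *)
  c = al *m mu ->
  (forall w, pimap k f w = al *m th w) ->
  (* (iii) *)
  closed B ->
  (forall b, B b -> `|b| <= bbar) ->
  0 <= rhobar < 1 ->
  (jsr [set (1%:M + b^T *m bold_alpha k.-1 al)%R | b in B] <= rhobar%:E)%E ->
  (forall (x x' : 'cV[R]_(q + r)) (y y' : 'cV[R]_(k.-1 * (q + r))),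
     exists2 b, B b &
       (bold_theta k f th (f0inv x) + D0mat (q + r) r k.-1 *m col_mx x y)
       - (bold_theta k f th (f0inv x') + D0mat (q + r) r k.-1 *m col_mx x' y')
       = b^T *m (col_mx x y - col_mx x' y')) ->
  (* alpha_perp *)
  \rank alperp = q ->
  alperp^T *m al = 0 ->
  (* the nonlinear VAR(k) recursion, given z_0, ..., z_{-k+1} and u_t, t >= 1 *)
  (forall t : int, 1 <= t ->
     f 0%N (z t) = c + \sum_(1 <= i < k.+1) f i (z (t - i%:Z)) + u t) ->
  exists chiinv : 'cV[R]_(q + r) -> 'cV[R]_(q + r),
    [/\ homeo (chi k f alperp th) chiinv,
        (forall t : nat, (1 <= t)%N ->
           z t%:Z = chiinv (col_mx (alperp^T *m hbar k f z
                                    + alperp^T *m \sum_(1 <= s < t.+1) u s%:Z)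
                                   (- mu)
                            + S_chiT k.-1 alperp *m bxi k f mu th z t%:Z)),
        (forall t : nat,
           bxi k f mu th z t%:Z
           = col_mx (mu + th (z t%:Z)) (bzeta k f z t%:Z - bzeta k f z (t%:Z - 1)))
      & exists beta : nat -> 'M[R]_(q + r + k.-1 * (q + r), r + k.-1 * (q + r)),
          (forall t : nat, (1 <= t)%N -> B (beta t)) /\
          exp_stable (fun _ => 0)
                     (fun t => 1%:M + (beta t)^T *m bold_alpha k.-1 al)
                     (fun t => (beta t)^T)
                     (fun t => bxi k f mu th z t%:Z)
                     (fun t => bu k.-1 u t%:Z)].
Proof.
(* With [k = m.+1], [k.-1] reduces to [m]. *)
case: k hk f B => // m _ f B f0 ral f0_homeo cE piE _ Bb rhobar01 jsrB inc rperp perp_al var.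
have [f0K f0invK f0c f0ic] := f0_homeo.
have bmapB Z Z' : exists2 b, B b &
    bold_map f f0inv th Z - bold_map f f0inv th Z' = b^T *m (Z - Z').
  have [b Bb' bE] := inc (usubmx Z) (usubmx Z') (dsubmx Z) (dsubmx Z').
  by exists b => //; move: bE; rewrite !vsubmxK.
have [chiinv chiP] := chi_homeo ral f0_homeo Bb rhobar01 jsrB bmapB rperp perp_al.
have incr t : 1 <= t -> f 0%N (z t) - f 0%N (z (t - 1)) =
    al *m (mu + th (z (t - 1))) + u t
    + (zeta m.+1 f z 1 (t - 1) - zeta m.+1 f z 1 (t - 1 - 1)).
  move=> t1; rewrite (@var_increment R (q + r) m f z c u t (var t t1)) cE piE.
  by rewrite -mulmxDr.
(* [alperp^T] annihilates the range of [al], so only the shocks accumulate. *)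
have walk (t : nat) : alperp^T *m (f 0%N (z t%:Z) - zeta m.+1 f z 1 (t%:Z - 1)) =
    alperp^T *m hbar m.+1 f z + alperp^T *m \sum_(1 <= s < t.+1) u s%:Z.
  elim: t => [|t IH].
    rewrite [in RHS]big_geq// mulmx0 addr0 /hbar /zeta; congr (_ *m (_ - _)).
    by apply: eq_bigr => i _; congr (gj _ _ _ (z _)); lia.
  rewrite [in RHS]big_nat_recr//= [X in _ = _ + X]mulmxDr addrA -IH -[in RHS]mulmxDr.
  have /= := incr t.+1%:Z isT; have -> : t.+1%:Z - 1 = t%:Z by lia.
  move=> /eqP; rewrite subr_eq => /eqP ->.
  rewrite (_ : _ - _ = al *m (mu + th (z t%:Z)) +
    (f 0%N (z t%:Z) - zeta m.+1 f z 1 (t%:Z - 1) + u t.+1%:Z)).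
    by rewrite mulmxDr mulmxA perp_al mul0mx add0r.
  move: (al *m _) (u _) (zeta _ _ _ _ _) (zeta _ _ _ _ _) (f _ _) => x1 x2 x3 x4 x5.
  by apply/colP => i; rewrite !mxE; ring.
pose xi t := bxi m.+1 f mu th z t.
(* The first block column of [D0mat] is zero, so [z t] may be replaced by [f 0 (z t)] in the stacked
   vector. *)
have xiE t : xi t = col_mx mu 0 +
    bold_map f f0inv th (col_mx (f 0%N (z t)) (bzeta m.+1 f z (t - 1))).
  by rewrite /xi /bxi bold_map_col f0K D0mat_col /bold_theta !add_col_mx !add0r addr0.
(* [B b] stands outside the implication so that [beta] takes values in [B] at [t = 0] too, as the
   word [bs] requires. *)
have dxi (t : nat) : exists b, B b /\ ((1 <= t)%N ->
    xi t%:Z = (1%:M + b^T *m bold_alpha m al) *m xi t.-1%:Z + b^T *m bu m u t%:Z).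
  have [b Bb' bE] := bmapB (col_mx (f 0%N (z t%:Z)) (bzeta m.+1 f z (t%:Z - 1)))
    (col_mx (f 0%N (z (t%:Z - 1))) (bzeta m.+1 f z (t%:Z - 1 - 1))).
  exists b; split => // t1; have -> : t.-1%:Z = t%:Z - 1 by lia.
  apply/eqP; rewrite mulmxDl mul1mx -addrA addrC -subr_eq -mulmxA -mulmxDr; apply/eqP.
  rewrite [in LHS]/= {1}xiE {1}xiE opprD addrACA subrr add0r bE; congr (_ *m _).
  rewrite opp_col_mx add_col_mx incr ?lez_nat// /xi bxiE bold_alpha_col mulmxBr !Emat_bzeta.
  by rewrite /bu add_col_mx addr0 addrAC.
have [beta betaP] := choice dxi.
exists chiinv; split => //.
- move=> t t1; have [chiK _ _ _] := chiP; rewrite -[LHS]chiK; congr chiinv.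
  rewrite -walk bxiE S_chiT_col add_col_mx addKr /chi; congr (col_mx _ _).
  have IrowE : Irow m (q + r) *m (bzeta m.+1 f z t%:Z - bzeta m.+1 f z (t%:Z - 1)) =
      Irow m (q + r) *m boldg m.+1 f (z t%:Z) - zeta m.+1 f z 1 (t%:Z - 1).
    by rewrite -Dmat_bzeta mulmxDr -Emat_bzeta Emat_Irow_Dmat opprK.
  by rewrite IrowE -mulmxBr hmapE opprB addrA subrK.
- by move=> t; exact: bxiE.
exists beta; split => [t _|]; first by case: (betaP t).
split.
- by move=> t t1; rewrite add0r; have [_ /(_ t1)] := betaP t.
- by exists bbar => t _; rewrite mx_norm_tr; apply: Bb; case: (betaP t).
- by exists 0 => t _; rewrite normr0.
have [K [rho [rho01 FK]]] := incremental_decay Bb rhobar01 jsrB.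
exists K, rho; split => // t.
pose bs s : {b | B b} := exist _ (beta s) (proj1 (betaP s)).
have := FK (map bs (index_iota 1 t.+1)).
rewrite size_map size_iota subSS subn0; congr (`|_| <= _).
by rewrite /lprod big_map /mxprod.
Qed.
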